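(* Let $K$ be the field of fractions of a Dedekind domain $\mathcal{O}_K$, let $L/K$ be a finite extension which is $H$-Galois for a Hopf-Galois structure $(H,\cdot)$ of dimension $n$, and let $\mathcal{O}_L$ be the integral closure of $\mathcal{O}_K$ in $L$. Assume $L$ has a $K$-basis $B=\{\gamma_j\}_{j=1}^n$ consisting of $H$-eigenvectors which is also an $\mathcal{O}_K$-basis of $\mathcal{O}_L$. Let $W=\{w_i\}_{i=1}^n$ be a $K$-basis of $H$, write $w_i\cdot\gamma_j=\lambda_{ij}\gamma_j$ with $\lambda_{ij}\in K$, let $\Lambda=(\lambda_{ij})_{i,j=1}^n$ and let $\Omega=(\omega_{ij})_{i,j=1}^n=\Lambda^{-1}$. Then: 1. The elements $v_i=\sum_{l=1}^n\omega_{il}w_l$, $1\le i\le n$, form an $\mathcal{O}_K$-basis of the associated order $\mathfrak{A}_H$, and they form a system of primitive pairwise orthogonal idempotents. 2. $\mathcal{O}_L$ is a free $\mathfrak{A}_H$-module, and any element $\beta=\sum_{j=1}^n\beta_j\gamma_j$ with $\beta_j\in\mathcal{O}_K^*$ for every $j$ is a free generator.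
   Context: A Hopf-Galois structure on a finite extension $L/K$ is a pair $(H,\cdot)$ with $H$ a finite-dimensional cocommutative $K$-Hopf algebra and $\cdot$ a $K$-linear action making $L$ an $H$-module algebra ($h\cdot1=\epsilon_H(h)$, $h\cdot(xy)=\sum_{(h)}(h_{(1)}\cdot x)(h_{(2)}\cdot y)$) such that $L\otimes_KH\to\mathrm{End}_K(L)$, $x\otimes h\mapsto(y\mapsto x(h\cdot y))$, is bijective; then $\dim_KH=[L:K]$. A nonzero $\alpha\in L$ is an $H$-eigenvector if for every $h\in H$ there is $\lambda(h)\in K$ with $h\cdot\alpha=\lambda(h)\alpha$. The associated order is $\mathfrak{A}_H=\{h\in H: h\cdot x\in\mathcal{O}_L \text{ for all } x\in\mathcal{O}_L\}$; $\mathcal{O}_L$ is an $\mathfrak{A}_H$-module via the action. *)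

(* Defs.v *)
From HB Require Import structures.
From mathcomp Require Import all_boot all_order all_algebra all_field.

Set Implicit Arguments.
Unset Strict Implicit.
Unset Printing Implicit Defensive.

Import GRing.Theory VectorInternalTheory.
Local Open Scope ring_scope.

Section TensorProduct.
Variable K : fieldType.

(* An element of U (x) V is given by its matrix of coordinates in the basis
   e_i (x) e_j, where the e_i are the bases of U and V underlying v2r. *)
Definition tensor (U V : vectType K) : vectType K := 'M[K]_(dim U, dim V).

Definition tens (U V : vectType K) (u : U) (v : V) : tensor U V :=
  (v2r u)^T *m v2r v.

(* The linear map on U (x) V induced by a bilinear map f; tensor_lift_tens is
   the universal property. When t is a coproduct, tensor_lift f t is the
   Sweedler sum of the f t_(1) t_(2). *)
Definition tensor_lift (U V T : vectType K) (f : U -> V -> T)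
    (t : tensor U V) : T :=
  \sum_i \sum_j t i j *: f (r2v (delta_mx 0 i)) (r2v (delta_mx 0 j)).

Lemma tensor_lift_is_linear (U V T : vectType K) (f : U -> V -> T) :
  linear (tensor_lift f).
Proof.
move=> a s t; rewrite /tensor_lift scaler_sumr -big_split /=.
apply: eq_bigr => i _; rewrite scaler_sumr -big_split /=.
by apply: eq_bigr => j _; rewrite !mxE scalerDl scalerA.
Qed.

Lemma tensor_lift_tens (U V T : vectType K) (f : U -> V -> T) :
    (forall v, linear (f^~ v)) -> (forall u, linear (f u)) ->
  forall u v, tensor_lift f (tens u v) = f u v.
Proof.
move=> fl fr u v.
have sum_lin (X : vectType K) (g : X -> T) (x : X) : linear g ->
    g x = \sum_i v2r x 0 i *: g (r2v (delta_mx 0 i)).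
  move=> gl; pose m := GRing.isLinear.Build K X T *:%R g gl.
  pose G : {linear X -> T} := HB.pack g m.
  rewrite -{1}[x]v2rK {1}[v2r x]row_sum_delta linear_sum.
  rewrite -[g]/(G : X -> T) linear_sum; apply: eq_bigr => i _.
  by rewrite (linearZ_LR r2v) linearZ_LR.
rewrite (sum_lin _ _ u (fl v)) /tensor_lift; apply: eq_bigr => i _.
rewrite (sum_lin _ _ v (fr _)) scaler_sumr; apply: eq_bigr => j _.
by rewrite scalerA !mxE big_ord1 !mxE.
Qed.

End TensorProduct.

Definition tensor_mul (K : fieldType) (H : falgType K) (s t : tensor H H) :
    tensor H H :=
  tensor_lift
    (fun a b => tensor_lift (fun c d => tens (a * c) (b * d)) t) s.

Record hopf_algebra (K : fieldType) (H : falgType K) := HopfAlgebra {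
  comul : {linear H -> tensor H H};
  counit : {linear H -> K | *%R};
  antipode : {linear H -> H};
  (* in H (x) (H (x) H) *)
  comulA : forall h,
    tensor_lift
      (fun a b => tensor_lift (fun a1 a2 => tens a1 (tens a2 b)) (comul a))
      (comul h)
    = tensor_lift (fun a b => tens a (comul b)) (comul h);
  counitl : forall h, tensor_lift (fun a b => counit a *: b) (comul h) = h;
  counitr : forall h, tensor_lift (fun a b => counit b *: a) (comul h) = h;
  comul1 : comul 1 = tens 1 1;
  comulM : forall g h, comul (g * h) = tensor_mul (comul g) (comul h);
  counit1 : counit 1 = 1;
  counitM : forall g h, counit (g * h) = counit g * counit h;
  antipodel : forall h,
    tensor_lift (fun a b => antipode a * b) (comul h) = (counit h)%:A;
  antipoder : forall h,
    tensor_lift (fun a b => a * antipode b) (comul h) = (counit h)%:A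
}.

Definition cocommutative (K : fieldType) (H : falgType K)
    (hH : hopf_algebra H) : Prop :=
  forall h, tensor_lift (fun a b => tens b a) (comul hH h) = comul hH h.

Definition galois_map (K : fieldType) (L : fieldExtType K) (H : falgType K)
    (act : H -> 'End(L)) : tensor L H -> 'End(L) :=
  tensor_lift (fun (x : L) (h : H) => (amull x \o act h)%VF).

Record hopf_galois (K : fieldType) (L : fieldExtType K) (H : falgType K) :=
  HopfGalois {
  hg_hopf : hopf_algebra H;
  hg_cocomm : cocommutative hg_hopf;
  hg_act : {linear H -> 'End(L)};
  hg_act1 : forall x : L, hg_act 1 x = x;
  hg_actM : forall g h (x : L), hg_act (g * h) x = hg_act g (hg_act h x);
  hg_act_one : forall h, hg_act h 1 = (counit hg_hopf h)%:A;
  hg_act_mul : forall h (x y : L),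
    hg_act h (x * y)
    = tensor_lift (fun a b => hg_act a x * hg_act b y) (comul hg_hopf h);
  hg_bij : bijective (galois_map hg_act)
}.

Definition eigenvector (K : fieldType) (L : fieldExtType K) (H : falgType K)
    (G : hopf_galois L H) (x : L) : Prop :=
  x != 0 /\ forall h : H, exists c : K, hg_act G h x = c *: x.

Section Dedekind.
Variable R : idomainType.

Definition is_ideal (I : R -> Prop) : Prop :=
  [/\ I 0, forall x y, I x -> I y -> I (x + y) & forall a x, I x -> I (a * x)].

Definition is_prime_ideal (I : R -> Prop) : Prop :=
  [/\ is_ideal I, ~ I 1 & forall x y, I (x * y) -> I x \/ I y].

Definition is_maximal_ideal (I : R -> Prop) : Prop :=
  [/\ is_ideal I, ~ I 1 &
      forall J, is_ideal J -> (forall x, I x -> J x) ->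
        (forall x, J x -> I x) \/ J 1].

Definition noetherian : Prop :=
  forall I, is_ideal I ->
    exists (m : nat) (g : 'I_m -> R),
      forall x, I x <-> exists c : 'I_m -> R, x = \sum_i c i * g i.

Definition integrally_closed : Prop :=
  forall z : {fraction R}, integralOver (@tofrac R) z ->
    exists a : R, z = tofrac a.

(* Fields are allowed. *)
Definition dedekind_domain : Prop :=
  [/\ noetherian, integrally_closed &
      forall I, is_prime_ideal I -> (exists2 x, I x & x != 0) ->
        is_maximal_ideal I].

End Dedekind.

Definition is_fraction_field (R : idomainType) (K : fieldType)
    (iota : {rmorphism R -> K}) : Prop :=
  injective iota
  /\ forall x : K, exists a b : R, b != 0 /\ x = iota a / iota b.

Definition integral_closure (R : idomainType) (K : fieldType)
    (iota : {rmorphism R -> K}) (L : fieldExtType K) (x : L) : Prop :=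
  integralOver (fun a : R => (iota a)%:A : L) x.

(* Scalars range over the subset S of A, acting on V through act, and e is a
   basis of the S-submodule M of V. *)
Definition module_basis (A : choiceType) (V : nmodType) (S : A -> Prop)
    (act : A -> V -> V) (M : V -> Prop) (I : finType) (e : I -> V) : Prop :=
  (forall i, M (e i)) /\
  forall x, M x ->
    exists! c : {ffun I -> A},
      (forall i, S (c i)) /\ x = \sum_i act (c i) (e i).

Definition is_basis_over (R : idomainType) (K : fieldType)
    (iota : {rmorphism R -> K}) (V : lmodType K) (M : V -> Prop)
    (n : nat) (e : 'I_n -> V) : Prop :=
  module_basis (fun _ : R => True) (fun a v => iota a *: v) M e.

Section AssociatedOrder.
Variables (R : idomainType) (K : fieldType) (iota : {rmorphism R -> K}).
Variables (L : fieldExtType K) (H : falgType K) (G : hopf_galois L H).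

Definition associated_order (h : H) : Prop :=
  forall x : L, integral_closure iota x -> integral_closure iota (hg_act G h x).

Definition is_order_basis (m : nat) (e : 'I_m -> L) : Prop :=
  module_basis associated_order (fun h x => hg_act G h x)
    (@integral_closure R K iota L) e.

Definition free_over_order : Prop :=
  exists (m : nat) (e : 'I_m -> L), is_order_basis e.

Definition free_generator (x : L) : Prop :=
  is_order_basis (fun _ : 'I_1 => x).

End AssociatedOrder.

Definition idempotent_elt (A : pzRingType) (e : A) : Prop := e * e = e.

Definition primitive_idempotent (A : pzRingType) (e : A) : Prop :=
  [/\ idempotent_elt e, e != 0 &
      forall f g : A, idempotent_elt f -> idempotent_elt g ->
        f * g = 0 -> g * f = 0 -> e = f + g -> f = 0 \/ g = 0].

(* Main.v *)
Require Import Defs.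
From HB Require Import structures.
From mathcomp Require Import all_boot all_order all_algebra all_field.

Set Implicit Arguments.
Unset Strict Implicit.
Unset Printing Implicit Defensive.

Import GRing.Theory VectorInternalTheory.
Local Open Scope ring_scope.

(** An element of [H] is determined by its action on [L], because
    [x (x) h |-> x (h . _)] is injective; hence it is determined by its
    eigenvalues on the basis [gamma], and [H] embeds in [K^n] as an algebra.
    Invertibility of [Lambda] is the independence of the rows of eigenvalues
    of the [w_i], and [v_i] is the element with eigenvalues
    [(delta_ij)_j], so [H] is [K^n] with the [v_i] as standard idempotents.
    As the [gamma_j] also span [O_L] over [O_K], an element of [H] preserves
    [O_L] iff all its eigenvalues lie in [O_K], and multiplying the
    coordinates of [beta], which are units, by the eigenvalues reaches each
    element of [O_L] exactly once. *)

Lemma free_sum_inj (K : fieldType) (V : vectType K) (n : nat) (X : n.-tuple V)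
    (a b : 'I_n -> K) :
  free X ->
  \sum_j a j *: tnth X j = \sum_j b j *: tnth X j -> a =1 b.
Proof.
move=> fX; have e c : \sum_j c j *: tnth X j = \sum_(j < n) c j *: X`_j.
  by apply: eq_bigr => j _; rewrite (tnth_nth 0).
by rewrite !e => eab j; rewrite -(coord_sum_free a j fX) eab coord_sum_free.
Qed.

(** The coordinates of a pure tensor are the products of those of [u] and [v], so one nonzero
    coordinate of [u] kills every coordinate of [v]. *)
Lemma tens_eq0 (K : fieldType) (U V : vectType K) (u : U) (v : V) :
  tens u v = 0 -> u = 0 \/ v = 0.
Proof.
have [-> | u0] := eqVneq u 0; first by left.
move=> uv0; right; apply: v2r_inj.
have /rV0Pn [i ui] : v2r u != 0.
  by rewrite -(linear0 v2r) (inj_eq (@v2r_inj _ _)).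
rewrite linear0; apply/rowP => j; have /matrixP/(_ i j) := uv0.
rewrite !mxE big_ord1 !mxE => /eqP; rewrite mulf_eq0 (negPf ui) /=.
by move/eqP.
Qed.

(** * Faithfulness of the action *)

Section HopfGaloisAction.
Variables (K : fieldType) (L : fieldExtType K) (H : falgType K).
Variable G : hopf_galois L H.

Lemma galois_map_tens (x : L) (h : H) :
  galois_map (hg_act G) (tens x h) = (amull x \o hg_act G h)%VF.
Proof.
rewrite /galois_map (tensor_lift_tens (f := fun x h => _)) // => y a s t.
  by rewrite linearP comp_lfunDl comp_lfunZl.
by rewrite linearP comp_lfunDr comp_lfunZr.
Qed.

Lemma hg_act_inj : injective (hg_act G).
Proof.
move=> g h egh; apply/eqP; rewrite -subr_eq0; apply/eqP.
have: tens (1 : L) (g - h) = 0.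
  apply: (bij_inj (hg_bij G)); rewrite galois_map_tens linearB /= egh subrr.
  rewrite comp_lfun0r; apply/esym.
  (* Linearity at scalar -1 and zero arguments shows that the Galois map sends 0 to 0. *)
  have := tensor_lift_is_linear
    (fun (x : L) (h : H) => (amull x \o hg_act G h)%VF) (-1) 0 0.
  by rewrite scaler0 addr0 scaleN1r addNr.
by case/tens_eq0 => // /eqP; rewrite oner_eq0.
Qed.

Lemma hg_act_inj_on_basis (n : nat) (gamma : n.-tuple L) (g h : H) :
  basis_of {:L} gamma ->
  (forall j, hg_act G g (tnth gamma j) = hg_act G h (tnth gamma j)) -> g = h.
Proof.
move=> hB egh; apply: hg_act_inj; apply/lfunP => x.
rewrite (coord_basis hB (memvf x)) !linear_sum; apply: eq_bigr => j _.
by rewrite !linearZ /= -tnth_nth egh.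
Qed.

End HopfGaloisAction.

(** * Eigenvalues on the basis [gamma] *)

Section DiagonalAction.
Variables (K : fieldType) (L : fieldExtType K) (H : falgType K).
Variables (G : hopf_galois L H) (n : nat) (gamma : n.-tuple L).
Hypothesis hB : basis_of {:L} gamma.
Hypothesis hBeig : forall j, eigenvector G (tnth gamma j).

(** Reading the eigenvalue off as a coordinate avoids choosing a witness and makes it visibly linear
    in [h]. *)
Let eigenval h j : K := coord gamma j (hg_act G h (tnth gamma j)).

Lemma hg_act_eigenval h j :
  hg_act G h (tnth gamma j) = eigenval h j *: tnth gamma j.
Proof.
have [_ /(_ h) [c e]] := hBeig j.
rewrite /eigenval e linearZ /= (tnth_nth 0) coord_free ?(basis_free hB) //.
by rewrite eqxx mulr1.
Qed.

Lemma eigenval_uniq h j c :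
  hg_act G h (tnth gamma j) = c *: tnth gamma j -> eigenval h j = c.
Proof.
rewrite hg_act_eigenval => /eqP; rewrite -subr_eq0 -scalerBl scaler_eq0.
have [/negPf-> _] := hBeig j.
by rewrite orbF subr_eq0 => /eqP.
Qed.

(** Identities in [H] are checked below through this, one eigenvalue at a time. *)
Lemma eigenval_inj g h : eigenval g =1 eigenval h -> g = h.
Proof.
move=> e; apply: (hg_act_inj_on_basis (G := G) hB) => j.
by rewrite !hg_act_eigenval e.
Qed.

Lemma eigenval0 j : eigenval 0 j = 0.
Proof. by rewrite /eigenval linear0 lfunE /= linear0. Qed.

Lemma eigenvalM g h j : eigenval (g * h) j = eigenval g j * eigenval h j.
Proof.
apply: eigenval_uniq.
by rewrite hg_actM (hg_act_eigenval h) linearZ /= hg_act_eigenval scalerA mulrC.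
Qed.

Lemma eigenval_sum (I : finType) (c : I -> K) (w : I -> H) j :
  eigenval (\sum_i c i *: w i) j = \sum_i c i * eigenval (w i) j.
Proof.
rewrite /eigenval linear_sum sum_lfunE linear_sum; apply: eq_bigr => i _.
by rewrite linearZ /= lfunE /= linearZ.
Qed.

Lemma hg_act_sum h (a : 'I_n -> K) :
  hg_act G h (\sum_j a j *: tnth gamma j)
  = \sum_j (eigenval h j * a j) *: tnth gamma j.
Proof.
rewrite linear_sum; apply: eq_bigr => j _.
by rewrite linearZ /= hg_act_eigenval scalerA mulrC.
Qed.

(** A row [u] with [u *m Lambda = 0] gives a combination of [W] with all eigenvalues zero; it
    vanishes, and so does [u] by freeness. *)
Lemma eigenval_mx_unit (W : n.-tuple H) (Lambda : 'M[K]_n) :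
  free W -> (forall i j, eigenval (tnth W i) j = Lambda i j) ->
  Lambda \in unitmx.
Proof.
move=> fW e; rewrite -row_free_unit; apply: inj_row_free => u u0.
have s0 : \sum_i u 0 i *: tnth W i = 0.
  apply: eigenval_inj => j; rewrite eigenval_sum eigenval0.
  have /matrixP/(_ 0 j) := u0; rewrite !mxE; apply: etrans.
  by apply: eq_bigr => i _; rewrite e.
apply/rowP => i; rewrite mxE.
apply: (free_sum_inj (b := fun=> 0) fW); rewrite s0 big1 // => k _.
by rewrite scale0r.
Qed.

(** * Idempotents dual to [gamma] *)

Section DualIdempotents.
Variable v : 'I_n -> H.
Hypothesis hv : forall i j, eigenval (v i) j = (i == j)%:R.

Lemma eigenval_dual_sum (c : 'I_n -> K) j :
  eigenval (\sum_i c i *: v i) j = c j.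
Proof.
rewrite eigenval_sum (bigD1 j) //= hv eqxx mulr1 big1 ?addr0 // => i ij.
by rewrite hv (negPf ij) mulr0.
Qed.

Lemma dual_orthogonal i j : i != j -> v i * v j = 0.
Proof.
move=> ij; apply: eigenval_inj => k; rewrite eigenvalM eigenval0 !hv.
by case: eqP => [<-|]; rewrite ?mul0r // eq_sym (negPf ij) mulr0.
Qed.

Lemma dual_primitive i : primitive_idempotent (v i).
Proof.
split.
- by apply: eigenval_inj => k; rewrite eigenvalM hv -natrM mulnb andbb.
- apply/eqP => /(congr1 (eigenval^~ i)) /eqP.
  by rewrite hv eqxx eigenval0 oner_eq0.
move=> f g If Ig fg gf e.
(* A summand [h] satisfies [h = h * v i], so its eigenvalues away from [i] vanish; only the one at
   [i] has to be tested. *)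
have v0 (h h' : H) : idempotent_elt h -> v i = h + h' -> h * h' = 0 ->
    eigenval h i = 0 -> h = 0.
  move=> Ih eh hh' hi; apply: eigenval_inj => k; rewrite eigenval0.
  have [<- //|ik] := eqVneq i k.
  have -> : h = h * v i by rewrite eh mulrDr hh' addr0 Ih.
  by rewrite eigenvalM hv (negPf ik) mulr0.
(* At [i] the eigenvalues of [f] and [g] have product 0 in the field [K], so one of them is 0. *)
have /eqP := congr1 (eigenval^~ i) fg.
rewrite eigenvalM eigenval0 mulf_eq0 => /orP [] /eqP h0.
  by left; apply: (v0 f g).
by right; apply: (v0 g f); rewrite // addrC.
Qed.

(** * Integrality of eigenvalues and coordinates *)

Section IntegralBasis.
Variables (R : idomainType) (iota : {rmorphism R -> K}).
Hypothesis iota_inj : injective iota.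
Hypothesis hBint :
  is_basis_over iota (@integral_closure R K iota L) (tnth gamma).

Lemma integral_closureP x :
  integral_closure iota x <->
  exists a : 'I_n -> R, x = \sum_j iota (a j) *: tnth gamma j.
Proof.
have [hmem hspan] := hBint; split.
  by move=> /hspan [c [[_ ->] _]]; exists c.
case=> a ->; pose f : {rmorphism R -> L} := in_alg L \o iota.
apply: (big_ind (integralOver f)); last 1 first.
- move=> j _; rewrite -mulr_algl; apply: integral_mul; last exact: hmem.
  exact: (integral_id f).
- by rewrite -(rmorph0 f); apply: integral_id.
- by move=> x1 x2; apply: integral_add.
Qed.

Lemma associated_orderP h :
  associated_order iota G h <-> forall j, exists a, eigenval h j = iota a.
Proof.
split=> [hO j | hE x /integral_closureP [a ->]].
  have /hO/integral_closureP [a] : integral_closure iota (tnth gamma j).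
    by have [] := hBint.
  rewrite hg_act_eigenval => e; exists (a j).
  (* The image of [gamma_j] has coordinates zero except the eigenvalue at [j]; uniqueness of
     coordinates over [K] identifies it with [iota (a j)]. *)
  rewrite -(@free_sum_inj K L n gamma (fun k => (k == j)%:R * eigenval h j)
              (fun k => iota (a k)) (basis_free hB)) ?eqxx ?mul1r //.
  rewrite -e (bigD1 j) //= eqxx mul1r big1 ?addr0 // => k /negPf->.
  by rewrite mul0r scale0r.
apply/integral_closureP.
have /fin_all_exists [b hb] := hE.
exists (fun j => b j * a j); rewrite hg_act_sum; apply: eq_bigr => j _.
by rewrite hb rmorphM.
Qed.

(** The coordinates of [h] in [v] are its eigenvalues, which are integral exactly on the associated
    order. *)
Lemma dual_order_basis : is_basis_over iota (associated_order iota G) v.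
Proof.
split=> [i | h /associated_orderP /fin_all_exists [a ha]].
  apply/associated_orderP => j; exists (i == j)%:R.
  by rewrite hv rmorph_nat.
exists (finfun a); split.
  split=> //; apply: eigenval_inj => j.
  by rewrite (eigenval_dual_sum (fun i => iota (finfun a i))) ffunE.
move=> c [_ e]; apply/ffunP => j; rewrite ffunE; apply: iota_inj.
by rewrite -ha e (eigenval_dual_sum (fun i => iota (c i))).
Qed.

Lemma unit_coords_free_generator (b : 'I_n -> R) :
  (forall j, b j \is a GRing.unit) ->
  free_generator iota G (\sum_j iota (b j) *: tnth gamma j).
Proof.
move=> ub; split=> [_|_ /integral_closureP [a ->]].
  by apply/integral_closureP; exists b.
(* To send the given generator to the target, [h] must have eigenvalues [a j / b j]; this quotient
   is taken in [R], where [b j] is a unit. *)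
pose h : H := \sum_i iota (a i / b i) *: v i.
have hE j : eigenval h j = iota (a j / b j).
  exact: (eigenval_dual_sum (fun i => iota (a i / b i))).
exists [ffun=> h]; split.
  split=> [i|].
    by rewrite ffunE; apply/associated_orderP => j; exists (a j / b j).
  rewrite big_ord1 ffunE hg_act_sum; apply: eq_bigr => j _.
  by rewrite hE -rmorphM divrK.
move=> c [_]; rewrite big_ord1 hg_act_sum.
move=> /(free_sum_inj (basis_free hB)) e.
apply/ffunP => i; rewrite ffunE ord1; apply: eigenval_inj => j.
have b0 : iota (b j) != 0.
  rewrite -(rmorph0 iota) (inj_eq iota_inj).
  by apply: contraTneq (ub j) => ->; rewrite unitr0.
by apply: (mulIf b0); rewrite hE -rmorphM divrK // e.
Qed.

End IntegralBasis.
End DualIdempotents.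
End DiagonalAction.

Theorem theorem1p2 (OK : idomainType) (K : fieldType)
    (iota : {rmorphism OK -> K}) (L : fieldExtType K) (H : falgType K)
    (G : hopf_galois L H) (n : nat) (gamma : n.-tuple L) (W : n.-tuple H)
    (Lambda : 'M[K]_n)
    (hOK : dedekind_domain OK)
    (hK : is_fraction_field iota)
    (hn : \dim {:H} = n)
    (hB : basis_of {:L} gamma)
    (hBeig : forall j, eigenvector G (tnth gamma j))
    (hBint : is_basis_over iota (@integral_closure OK K iota L) (tnth gamma))
    (hW : basis_of {:H} W)
    (hLambda : forall i j,
      hg_act G (tnth W i) (tnth gamma j) = Lambda i j *: tnth gamma j) :
  let Omega := invmx Lambda in
  let v := fun i : 'I_n => \sum_l Omega i l *: tnth W l in
  Lambda \in unitmx /\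
  (is_basis_over iota (associated_order iota G) v /\
   (forall i, primitive_idempotent (v i)) /\
   (forall i j, i != j -> v i * v j = 0)) /\
  (free_over_order iota G /\
   forall b : 'I_n -> OK, (forall j, b j \is a GRing.unit) ->
     free_generator iota G (\sum_j iota (b j) *: tnth gamma j)).
Proof.
move=> Omega v; have [iota_inj _] := hK.
have eW i j := eigenval_uniq hB hBeig (hLambda i j).
have uL := eigenval_mx_unit hB hBeig (basis_free hW) eW.
(* The eigenvalues of [v i] form row [i] of [Omega *m Lambda], the identity. *)
have ev i j : coord gamma j (hg_act G (v i) (tnth gamma j)) = (i == j)%:R.
  rewrite eigenval_sum.
  have /matrixP/(_ i j) := mulVmx uL; rewrite !mxE; apply: etrans.
  by apply: eq_bigr => l _; rewrite eW.
have gen := unit_coords_free_generator hB hBeig ev iota_inj hBint.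
split=> //; split.
  split; first exact: (dual_order_basis hB hBeig ev iota_inj hBint).
  by split; [exact: (dual_primitive hB hBeig ev)
            | exact: (dual_orthogonal hB hBeig ev)].
(* Freeness has rank one: the sum of the [gamma_j], with all coordinates 1, is a generator. *)
split=> //; exists 1, (fun=> \sum_j iota 1 *: tnth gamma j).
by apply: (gen (fun=> 1)) => j; apply: unitr1.
Qed.
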